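(* Let $A=(a_{ij})\in\mathbb{R}^{d\times d}$ be a matrix with tropical diameter $\operatorname{tdiam} A=2$, and take $\oplus=\max$ as the tropical addition. Then $\operatorname{tvol} A\le 2$. Moreover, if $\operatorname{tvol} A=2$, then $A$ is equivalent to a $\max$-standard matrix whose coefficients $a_{ij}$ satisfy: (i) $-1\le a_{ij}\le 1$ for all $i,j$; (ii) $a_{ii}=1$ for all $i$; (iii) $a_{ji}=-a_{ij}$ for $i\neq j$; (iv) $-1\le a_{ij}+a_{jk}+a_{ki}\le 1$ for pairwise distinct $i,j,k$. Conversely, every $\max$-standard $d\times d$ matrix satisfying (i)–(iv) has tropical diameter equal to $2$ and tropical volume equal to $2$.
   Context: For $v,w\in\mathbb{R}^d$ the tropical distance is $\operatorname{tdist}(v,w)=\max_{i\in[d]}(v_i-w_i)-\min_{i\in[d]}(v_i-w_i)$. For $A=(a_{ij})\in\mathbb{R}^{d\times d}$ with rows $a_{i\cdot}$, the tropical diameter is $\operatorname{tdiam} A=\max_{i,j}\operatorname{tdist}(a_{i\cdot},a_{j\cdot})=\max_{i,j,k,\ell}|a_{ik}-a_{i\ell}+a_{j\ell}-a_{jk}|$. With $\oplus=\max$, the tropical volume is $\operatorname{tvol}A=\bigl|\max_{\sigma\in\mathrm{Sym}(d)}\sum_i a_{i\sigma(i)}-\max_{\tau\in\mathrm{Sym}(d)\setminus\{\sigma_{\mathrm{opt}}\}}\sum_i a_{i\tau(i)}\bigr|$, where $\sigma_{\mathrm{opt}}$ is a permutation attaining the first maximum. Two square matrices are equivalent if one can be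 transformed into the other by a sequence of permutations of rows, permutations of columns, adding a real constant to all entries of a row, and adding a real constant to all entries of a column. A matrix is $\max$-standard if the identity permutation attains $\max_{\sigma}\sum_i a_{i\sigma(i)}$ and its first row and its first column both read $(1,0,0,\dots,0)$. *)

(* Defs.v *)
From HB Require Import structures.
From Stdlib Require Import Relation_Operators.
From mathcomp Require Import all_boot all_order all_fingroup all_algebra.
From mathcomp Require Import reals.

Set Implicit Arguments.
Unset Strict Implicit.
Unset Printing Implicit Defensive.

Import Order.TTheory GRing.Theory Num.Theory.

Local Open Scope ring_scope.

Section FiniteExtrema.
Variables (R : realType) (I : finType).
Implicit Types (P : pred I) (F : I -> R).

(* Maximum and minimum of a real function over a finite index set; 0 is a junk
   value, returned only when no index satisfies P. *)
Definition fmax P F : R :=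
  if [pick i | P i] is Some i0 then \big[Num.max/F i0]_(i | P i) F i else 0.

Definition fmin P F : R :=
  if [pick i | P i] is Some i0 then \big[Num.min/F i0]_(i | P i) F i else 0.

Lemma fmax_ge P F i : P i -> F i <= fmax P F.
Proof.
move=> Pi; rewrite /fmax; case: pickP => [i0 _|/(_ i)]; last by rewrite Pi.
by rewrite (bigD1 i) //= le_max lexx.
Qed.

Lemma fmax_attained P F i : P i -> exists2 j, P j & fmax P F = F j.
Proof.
move=> Pi; rewrite /fmax; case: pickP => [i0 Pi0|/(_ i)]; last by rewrite Pi.
apply: (big_ind (fun x => exists2 j, P j & x = F j)); first by exists i0.
- move=> x y [j Pj ->] [k Pk ->].
  by case: (leP (F j) (F k)) => _; [exists k | exists j].
- by move=> j Pj; exists j.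
Qed.

Lemma fmin_le P F i : P i -> fmin P F <= F i.
Proof.
move=> Pi; rewrite /fmin; case: pickP => [i0 _|/(_ i)]; last by rewrite Pi.
by rewrite (bigD1 i) //= ge_min lexx.
Qed.

Lemma fmin_attained P F i : P i -> exists2 j, P j & fmin P F = F j.
Proof.
move=> Pi; rewrite /fmin; case: pickP => [i0 Pi0|/(_ i)]; last by rewrite Pi.
apply: (big_ind (fun x => exists2 j, P j & x = F j)); first by exists i0.
- move=> x y [j Pj ->] [k Pk ->].
  by case: (leP (F j) (F k)) => _; [exists j | exists k].
- by move=> j Pj; exists j.
Qed.

End FiniteExtrema.

Section Tropical.
Variables (R : realType) (d : nat).
Implicit Types (v w : 'rV[R]_d) (A B : 'M[R]_d) (s t : 'S_d).

Definition tdist v w : R :=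
  fmax predT (fun i => v 0 i - w 0 i) - fmin predT (fun i => v 0 i - w 0 i).

Definition tdiam A : R :=
  fmax predT (fun ij : 'I_d * 'I_d => tdist (row ij.1 A) (row ij.2 A)).

Definition tsum A s : R := \sum_(i < d) A i (s i).

(* The tropical determinant for max-plus addition. *)
Definition tdet A : R := fmax predT (tsum A).

Definition sigma_opt A : 'S_d := [arg max_(s > 1%g : 'S_d) tsum A s]%O.

(* For d < 2 there is no second permutation and the value is meaningless. *)
Definition tvol A : R :=
  `| tdet A - fmax (fun t => t != sigma_opt A) (tsum A) |.

Lemma sigma_optP A : tsum A (sigma_opt A) = tdet A.
Proof.
rewrite /sigma_opt; case: arg_maxP => //= s _ smax.
apply/eqP; rewrite eq_le fmax_ge //=.
by rewrite /tdet; have [t _ ->] := @fmax_attained R _ predT (tsum A) 1%g isT; apply: smax.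
Qed.

(* tvol does not depend on the choice of the optimal permutation. *)
Lemma tvolE A s : tsum A s = tdet A ->
  tvol A = `| tdet A - fmax (fun t => t != s) (tsum A) |.
Proof.
move=> sopt; rewrite /tvol; have := sigma_optP A.
have [->//|ne uopt] := eqVneq s (sigma_opt A).
have maxE (u v : 'S_d) : u != v -> tsum A u = tdet A ->
  fmax (fun t => t != v) (tsum A) = tdet A.
  move=> uv uE; apply/eqP; rewrite eq_le -{2}uE fmax_ge // andbT.
  have [t _ ->] := @fmax_attained R _ (fun t => t != v) (tsum A) u uv.
  exact: fmax_ge.
by rewrite (maxE s) // (maxE (sigma_opt A)) // eq_sym.
Qed.

Inductive mx_step A : 'M[R]_d -> Prop :=
| step_row_perm s : mx_step A (row_perm s A)
| step_col_perm s : mx_step A (col_perm s A)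
| step_row_add (i : 'I_d) (c : R) :
    mx_step A (\matrix_(k, l) (if k == i then A k l + c else A k l))
| step_col_add (j : 'I_d) (c : R) :
    mx_step A (\matrix_(k, l) (if l == j then A k l + c else A k l)).

Definition mx_equiv A B : Prop := clos_refl_trans _ mx_step A B.

Definition max_standard A : Prop :=
  [/\ tsum A 1%g = tdet A,
      forall i j : 'I_d, i = 0%N :> nat -> A i j = (if j == 0%N :> nat then 1 else 0)
    & forall i j : 'I_d, j = 0%N :> nat -> A i j = (if i == 0%N :> nat then 1 else 0)].

Definition extremal_coefs A : Prop :=
  [/\ forall i j, -1 <= A i j <= 1,
      forall i, A i i = 1,
      forall i j, i != j -> A j i = - A i j
    & forall i j k, i != j -> j != k -> k != i ->
        -1 <= A i j + A j k + A k i <= 1].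

End Tropical.

(* Main.v *)
Require Import Defs.
From Stdlib Require Import Relation_Operators.
From mathcomp Require Import all_boot all_order all_fingroup all_algebra.
From mathcomp Require Import reals lra.

Set Implicit Arguments.
Unset Strict Implicit.
Unset Printing Implicit Defensive.

Import Order.TTheory GRing.Theory Num.Theory.

Local Open Scope ring_scope.

(** The volume is at most the loss of weight caused by composing an optimal
    permutation with a transposition, and this loss is one of the 2x2
    expressions bounded by the diameter. If the volume is 2, all these losses
    equal 2; once the matrix is rescaled to have first row and column
    (1,0,...,0), this forces a unit diagonal and skew-symmetry, and the losses
    of the 3-cycles give (iv), of which (i) is the case where one index is the
    first.

    Conversely, (iv) lets one shorten a cycle by one element without decreasing
    the weight of a permutation, until a 2-cycle is reached, whose loss is 2.
    It also places all the differences of two rows i and j in the interval of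
    length 2 centred at [A i j]. *)

(** * The diameter as a maximum of 2x2 expressions in the entries *)

Section Diameter.
Variables (R : realType) (d : nat).
Implicit Types (A : 'M[R]_d) (i j k l : 'I_d).

Lemma entries_le_tdiam A i j k l :
  A i k - A j k - (A i l - A j l) <= tdiam A.
Proof.
rewrite /tdiam.
apply: le_trans (@fmax_ge R _ predT
  (fun ij : 'I_d * 'I_d => tdist (row ij.1 A) (row ij.2 A)) (i, j) isT).
rewrite /tdist /=; pose F l := row i A 0 l - row j A 0 l; rewrite -/F.
have := @fmax_ge R _ predT F k isT.
have := @fmin_le R _ predT F l isT.
rewrite /F !mxE; lra.
Qed.

Lemma tdiam_attained A (i0 : 'I_d) :
  exists i j k l, tdiam A = A i k - A j k - (A i l - A j l).
Proof.
rewrite /tdiam; have [[i j] _ -> /=] := @fmax_attained R _ predT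
  (fun ij : 'I_d * 'I_d => tdist (row ij.1 A) (row ij.2 A)) (i0, i0) isT.
rewrite /tdist; pose F k := row i A 0 k - row j A 0 k; rewrite -/F.
have [k _ ->] := @fmax_attained R _ predT F i0 isT.
have [l _ ->] := @fmin_attained R _ predT F i0 isT.
by exists i, j, k, l; rewrite /F !mxE.
Qed.

End Diameter.

(** For [d = 0] the diameter is the junk value of [fmax]; for [d = 1] every difference cancels. *)
Lemma tdiam_neq0 (R : realType) (d : nat) (A : 'M[R]_d) :
  tdiam A != 0 -> (1 < d)%N.
Proof.
case: d A => [|[|d]] A //.
  by rewrite /tdiam /fmax; case: pickP => [[[]]//|]; rewrite eqxx.
have [i [j [k [l ->]]]] := tdiam_attained A ord0.
by rewrite !ord1 !subrr eqxx.
Qed.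

(** * Weights of permutations changed by a transposition or a 3-cycle *)

Section Permutations.
Variables (R : realType) (d : nat).
Implicit Types (A B : 'M[R]_d) (s t : 'S_d) (i j k : 'I_d).

Lemma tsum_le_tdet A s : tsum A s <= tdet A.
Proof. exact: fmax_ge. Qed.

Lemma tvol_le A t : t != sigma_opt A -> tvol A <= tdet A - tsum A t.
Proof.
move=> tne; rewrite /tvol.
have le_t := @fmax_ge R _ (fun t => t != sigma_opt A) (tsum A) t tne.
have [u _ maxE] := @fmax_attained R _ (fun t => t != sigma_opt A) (tsum A) t tne.
rewrite ger0_norm; first by lra.
by rewrite maxE subr_ge0 tsum_le_tdet.
Qed.

(** Products apply the left factor first, so [tperm i j * s] only exchanges the images of [i] and
    [j] under [s]. *)
Lemma tsum_tperm A i j s : i != j ->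
  tsum A (tperm i j * s)%g =
  tsum A s - A i (s i) - A j (s j) + A i (s j) + A j (s i).
Proof.
move=> neq; rewrite /tsum.
rewrite (bigD1 i) //= (bigD1 j) 1?eq_sym //=.
rewrite [in RHS](bigD1 i) //= [in RHS](bigD1 j) 1?eq_sym //=.
rewrite !permM tpermL tpermR.
set S := \sum_(_ < d | _) _; set S' := \sum_(_ < d | _) _.
suff -> : S = S' by lra.
apply: eq_bigr => k /andP[ki kj].
by rewrite permM tpermD // eq_sym.
Qed.

Lemma tsum_cycle2 A i j : i != j ->
  tsum A (tperm i j) = tsum A 1%g - A i i - A j j + A i j + A j i.
Proof. by move=> neq; rewrite -[tperm i j]mulg1 tsum_tperm // !perm1. Qed.

(** The product is the cycle [i -> j -> k -> i]. *)
Lemma tsum_cycle3 A i j k : i != j -> j != k -> k != i ->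
  tsum A (tperm i j * tperm i k)%g =
  tsum A 1%g - A i i - A j j - A k k + A i j + A j k + A k i.
Proof.
move=> ij jk ki; rewrite tsum_tperm // tsum_cycle2 1?eq_sym // tpermL.
rewrite tpermD 1?eq_sym //; first by lra.
by rewrite eq_sym.
Qed.

Lemma tperm_neq1 i j : i != j -> tperm i j != 1%g.
Proof.
by apply: contra => /eqP/permP/(_ i); rewrite tpermL perm1 => ->.
Qed.

Lemma cycle3_neq1 i j k : i != j -> j != k -> (tperm i j * tperm i k)%g != 1%g.
Proof.
move=> ij jk; apply/eqP => /permP/(_ j); rewrite permM tpermR tpermL perm1.
by move/eqP; rewrite eq_sym (negPf jk).
Qed.

(** Permuting the columns by an optimal permutation thus makes the identity optimal. *)
Lemma tsum_col_perm A s t : tsum (col_perm s A) t = tsum A (t * s)%g.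
Proof. by apply: eq_bigr => i _; rewrite mxE permM. Qed.

Lemma tsum_col_perm_opt_le A t : t != 1%g ->
  tsum (col_perm (sigma_opt A) A) t <=
  tsum (col_perm (sigma_opt A) A) 1%g - tvol A.
Proof.
move=> t1; rewrite !tsum_col_perm mul1g sigma_optP.
have /tvol_le : (t * sigma_opt A)%g != sigma_opt A.
  by apply: contra t1 => /eqP e; apply/eqP/(mulIg (sigma_opt A)); rewrite mul1g.
lra.
Qed.

Lemma tvol_le_tdiam A : (1 < d)%N -> tvol A <= tdiam A.
Proof.
move=> d1; pose i := Ordinal (ltnW d1); pose j := Ordinal d1.
have ij : i != j by [].
have := tsum_col_perm_opt_le A (tperm_neq1 ij).
rewrite tsum_cycle2 // !mxE.
have := entries_le_tdiam A i j (sigma_opt A i) (sigma_opt A j).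
lra.
Qed.

End Permutations.

(** * Adding constants to all rows and columns at once *)

Section Rescaling.
Variables (R : realType) (d : nat).
Implicit Types (A : 'M[R]_d) (r c : 'I_d -> R).

Definition rescale A r c : 'M[R]_d := \matrix_(i, j) (A i j + r i + c j).

Lemma tsum_rescale A r c s :
  tsum (rescale A r c) s = tsum A s + (\sum_i r i + \sum_i c i).
Proof.
rewrite /tsum [X in _ + (_ + X)](reindex_inj (@perm_inj _ s)) /=.
by rewrite -!big_split; apply: eq_bigr => i _; rewrite mxE /= addrA.
Qed.

Lemma sum_pred1 r (k : 'I_d) :
  \sum_i (if k == i then r i else 0) = r k.
Proof.
by rewrite -big_mkcond (eq_bigl (pred1 k)) ?big_pred1_eq // => i /=; exact: eq_sym.
Qed.

Lemma mx_equiv_rescale A r c : mx_equiv A (rescale A r c).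
Proof.
apply: (@rt_trans _ _ _ (\matrix_(k, l) (A k l + r k))).
  (* Induction on the list [s] of rows already treated: each [i] costs one elementary step, and over
     the full enumeration [f s k] is [r k]. The columns follow in the same way. *)
  pose f s k := \sum_(i <- s) (if k == i then r i else 0).
  suff H s : mx_equiv A (\matrix_(k, l) (A k l + f s k)).
    have := H (index_enum 'I_d); congr mx_equiv.
    by apply/matrixP => k l; rewrite !mxE /f sum_pred1.
  elim: s => [|i s IH].
    suff -> : \matrix_(k, l) (A k l + f [::] k) = A by exact: rt_refl.
    by apply/matrixP => k l; rewrite !mxE /f big_nil addr0.
  apply: rt_trans IH _; apply: rt_step.
  have := step_row_add (\matrix_(k, l) (A k l + f s k)) i (r i).
  congr mx_step; apply/matrixP => k l; rewrite !mxE /f big_cons.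
  by case: eqP => _; lra.
set B := (X in clos_refl_trans _ _ X _).
pose f s k := \sum_(i <- s) (if k == i then c i else 0).
suff H s : mx_equiv B (\matrix_(k, l) (B k l + f s l)).
  have := H (index_enum 'I_d); congr mx_equiv.
  by apply/matrixP => k l; rewrite !mxE /f sum_pred1.
elim: s => [|i s IH].
  suff -> : \matrix_(k, l) (B k l + f [::] l) = B by exact: rt_refl.
  by apply/matrixP => k l; rewrite !mxE /f big_nil addr0.
apply: rt_trans IH _; apply: rt_step.
have := step_col_add (\matrix_(k, l) (B k l + f s l)) i (c i).
congr mx_step; apply/matrixP => k l; rewrite !mxE /f big_cons.
by case: eqP => _; lra.
Qed.

End Rescaling.

Lemma extremal_normal_form (R : realType) (n : nat) (A : 'M[R]_n.+1) :
  tdiam A = 2 -> tvol A = 2 ->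
  exists B, [/\ mx_equiv A B, max_standard B & extremal_coefs B].
Proof.
move=> diam2 vol2; set s := sigma_opt A; pose C := col_perm s A.
have loss t : t != 1%g -> tsum C t <= tsum C 1%g - 2.
  by move=> t1; rewrite -vol2 tsum_col_perm_opt_le.
(* The volume bounds this loss below by 2, the diameter bounds it above by 2. *)
have loss2 i j : i != j -> C i i + C j j - C i j - C j i = 2.
  move=> ij; have := loss _ (tperm_neq1 ij); rewrite tsum_cycle2 //.
  have := entries_le_tdiam A i j (s i) (s j); rewrite diam2 !mxE; lra.
have loss3 i j k : i != j -> j != k -> k != i ->
    2 <= C i i + C j j + C k k - C i j - C j k - C k i.
  move=> ij jk ki; have := loss _ (cycle3_neq1 ij jk).
  rewrite tsum_cycle3 //; lra.
(* These constants are forced, up to a shift between [r] and [c], by the first row and column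
   [(1,0,...,0)]. *)
pose r i := if i == ord0 then 0 else C ord0 ord0 - 1 - C i ord0.
pose c j := if j == ord0 then 1 - C ord0 ord0 else - C ord0 j.
pose B := rescale C r c.
have BE i j : B i j = C i j + r i + c j by rewrite mxE.
have row0 j : B ord0 j = if j == ord0 then 1 else 0.
  by rewrite BE /r /c eqxx; case: eqP => [->|_]; lra.
have col0 i : B i ord0 = if i == ord0 then 1 else 0.
  by rewrite BE /r /c eqxx; case: eqP => [->|_]; lra.
have diag i : B i i = 1.
  have [->|i0] := eqVneq i ord0; first by rewrite row0 eqxx.
  (* Rescaling preserves losses, and the one of [i] and [ord0] is now [B i i + 1]. *)
  by have := loss2 _ _ i0; rewrite BE /r /c (negPf i0); lra.
have skew i j : i != j -> B j i = - B i j.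
  move=> /loss2; have := diag i; have := diag j; rewrite !BE; lra.
have cyc i j k : i != j -> j != k -> k != i -> B i j + B j k + B k i <= 1.
  move=> ij jk ki; have := loss3 _ _ _ ij jk ki.
  have := diag i; have := diag j; have := diag k; rewrite !BE; lra.
have cyc2 i j k : i != j -> j != k -> k != i ->
    -1 <= B i j + B j k + B k i <= 1.
  move=> ij jk ki; apply/andP; split; last exact: cyc.
  (* By skew-symmetry the reversed cycle has the opposite sum, which gives the lower bound. *)
  have := cyc i k j; rewrite (skew _ _ ki) (skew _ _ jk) (skew _ _ ij).
  rewrite eq_sym ki eq_sym jk eq_sym ij => /(_ isT isT isT); lra.
exists B; split.
- apply: rt_trans (mx_equiv_rescale C r c).
  exact/rt_step/step_col_perm.
- split=> [|i j i0|i j j0].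
  + apply/eqP; rewrite eq_le tsum_le_tdet /=.
    have [t _ tE] := @fmax_attained R _ predT (tsum B) 1%g isT.
    (* Rescaling shifts all weights by the same constant, so the identity stays optimal. *)
    rewrite /tdet tE !tsum_rescale lerD2r.
    by have [->//|/loss] := eqVneq t 1%g; lra.
  + have -> : i = ord0 by exact: val_inj.
    by rewrite row0.
  + have -> : j = ord0 by exact: val_inj.
    by rewrite col0.
- split=> // i j.
  have [<-|ij] := eqVneq i j; first by rewrite diag; lra.
  have [->|i0] := eqVneq i ord0; first by rewrite row0; case: ifP => _; lra.
  have [->|j0] := eqVneq j ord0; first by rewrite col0; case: ifP => _; lra.
  have := cyc2 ord0 i j; rewrite row0 col0 (negPf i0) (negPf j0) eq_sym i0.
  by move/(_ isT ij isT); lra.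
Qed.

(** * Volume and diameter of matrices satisfying (i)-(iv) *)

Section ExtremalMatrices.
Variables (R : realType) (d : nat) (A : 'M[R]_d).
Hypothesis extA : extremal_coefs A.

Lemma tsum1_extremal : tsum A 1%g = d%:R.
Proof.
have [_ diag _ _] := extA.
rewrite /tsum (eq_bigr (fun=> 1)); last by move=> i _; rewrite perm1.
by rewrite sumr_const card_ord.
Qed.

Lemma tsum_extremal_le (s : 'S_d) : s != 1%g -> tsum A s <= d%:R - 2.
Proof.
have [bnd diag skew cyc] := extA.
(* Induction on the number of points moved by [s]. *)
have [n] := ubnP #|[set i | s i != i]|.
elim: n s => // n IH s len s1.
have [i si] : exists i, s i != i.
  apply/existsP; apply: contraR s1; rewrite negb_exists => /forallP H.
  by apply/eqP/permP => i; rewrite perm1; apply/eqP/negPn/H.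
have ij : i != s i by rewrite eq_sym.
set j := s i in si ij; have := tsum_tperm A s ij; rewrite -/j.
(* If [i] and [j] form a 2-cycle, undoing it gains exactly 2, and no weight exceeds [d] because
   entries are at most 1. *)
have [sji|sji] := eqVneq (s j) i.
  rewrite sji diag (skew _ _ ij) diag.
  suff : tsum A (tperm i j * s)%g <= d%:R by lra.
  rewrite -[leRHS]tsum1_extremal; apply: ler_sum => k _.
  by rewrite perm1 diag; have /andP[] := bnd k ((tperm i j * s)%g k).
have sjj : j != s j.
  by apply: contra ij => /eqP e; apply/eqP/(@perm_inj _ s).
(* Bypassing [j] changes the weight by [1 - (A i j + A j (s j) + A (s j) i)], which is nonnegative
   by (iv). *)
have := cyc _ _ _ ij sjj sji; rewrite diag (skew i (s j)) 1?eq_sym //.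
have ti : (tperm i j * s)%g i = s j by rewrite permM tpermL.
have tj : (tperm i j * s)%g j = j by rewrite permM tpermR.
suff : tsum A (tperm i j * s)%g <= d%:R - 2 by lra.
apply: IH; last first.
  by apply/eqP => /permP/(_ i)/eqP; rewrite ti perm1 (negPf sji).
rewrite ltnS in len; apply: leq_trans len; apply: proper_card.
apply/properP; split; last by exists j; rewrite !inE ?tj ?eqxx // eq_sym.
apply/subsetP => k; rewrite !inE.
have [->|ki] := eqVneq k i; first by move=> _; exact: si.
have [->|kj] := eqVneq k j; first by rewrite tj eqxx.
by rewrite permM tpermD // eq_sym.
Qed.

(** For [k] distinct from [i] and [j] this is (iv) after one use of skew-symmetry; [k = i] and
    [k = j] give the endpoints 1 and -1. *)
Lemma row_diff_extremal i j k : i != j -> `|A i k - A j k - A i j| <= 1.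
Proof.
have [_ diag skew cyc] := extA; move=> ij; rewrite ler_norml.
have [->|ki] := eqVneq k i; first by rewrite diag skew //; lra.
have [->|kj] := eqVneq k j; first by rewrite diag; lra.
have jk : j != k by rewrite eq_sym.
have := cyc _ _ _ ij jk ki.
rewrite (skew i k) 1?eq_sym //; lra.
Qed.

Lemma tvol_extremal : (1 < d)%N -> tsum A 1%g = tdet A -> tvol A = 2.
Proof.
move=> d1 opt1; rewrite (tvolE opt1) -opt1 tsum1_extremal.
pose i := Ordinal (ltnW d1); pose j := Ordinal d1.
have ij : i != j by [].
have t1 := tperm_neq1 ij.
have [_ diag skew _] := extA.
(* The transposition attains the bound [d - 2], as its two off-diagonal entries cancel. *)
have := @fmax_ge R _ (fun t : 'S_d => t != 1%g) (tsum A) _ t1.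
have [t /tsum_extremal_le le_t ->] :=
  @fmax_attained R _ (fun t : 'S_d => t != 1%g) (tsum A) _ t1.
rewrite tsum_cycle2 // tsum1_extremal !diag (skew _ _ ij) => ge_t.
have -> : tsum A t = d%:R - 2 by lra.
by rewrite opprB addrCA subrr addr0 ger0_norm.
Qed.

Lemma tdiam_extremal : (1 < d)%N -> tdiam A = 2.
Proof.
move=> d1; pose i := Ordinal (ltnW d1); pose j := Ordinal d1.
have ij : i != j by [].
have [_ diag skew _] := extA.
apply/eqP; rewrite eq_le; apply/andP; split; last first.
  (* On rows and columns [i], [j] the 2x2 expression is exactly 2. *)
  have := entries_le_tdiam A i j i j; rewrite !diag (skew _ _ ij); lra.
have [i' [j' [k [l ->]]]] := tdiam_attained A i.
have [->|ij'] := eqVneq i' j'; first by lra.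
have := row_diff_extremal k ij'; have := row_diff_extremal l ij'.
rewrite !ler_norml; lra.
Qed.

End ExtremalMatrices.

Theorem mainTheorem1 (R : realType) (d : nat) :
  (forall A : 'M[R]_d, tdiam A = 2 ->
     tvol A <= 2 /\
     (tvol A = 2 ->
        exists B : 'M[R]_d,
          [/\ mx_equiv A B, max_standard B & extremal_coefs B])) /\
  ((1 < d)%N ->
     forall A : 'M[R]_d, max_standard A -> extremal_coefs A ->
       tdiam A = 2 /\ tvol A = 2).
Proof.
split=> [A diam2|d1 A [opt1 _ _] extA]; last first.
  by split; [exact: tdiam_extremal | exact: tvol_extremal].
have d1 : (1 < d)%N by apply: (@tdiam_neq0 R d A); rewrite diam2 pnatr_eq0.
split; first by rewrite -diam2 tvol_le_tdiam.
by case: d d1 A diam2 => // n _ A; exact: extremal_normal_form.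
Qed.
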